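(* Let $A,B,C,D\in\mathbb{R}^{n\times n}$, let $\mathcal M=\begin{bmatrix} C & D \\ A & -B \end{bmatrix}$, and assume that the pencil $\varphi(z)=\mathcal M+z\mathcal M^\top$ is regular. Let $\mathcal U$ be an $n$-dimensional deflating subspace of $\varphi(z)$ whose associated set $\mathcal S$ of eigenvalues is reciprocal-free, and let $U_1,U_2\in\mathbb{C}^{n\times n}$ be such that the columns of $\begin{bmatrix} U_1 \\ U_2 \end{bmatrix}$ form a basis of $\mathcal U$. If $U_1$ is invertible, then for every $z\in\mathbb{C}$ with $z\notin\mathcal S$ the $n\times 2n$ matrix $$\begin{bmatrix} A+zD^\top & -B-zB^\top\end{bmatrix}$$ has rank $n$.
   Context: A matrix pencil $p(z)=E+zF$ with $E,F\in\mathbb{C}^{N\times N}$ is regular if $\det p(z)$ is not the zero polynomial. The finite eigenvalues of a regular pencil are the zeros of $\det p(z)$, and $\infty$ is an eigenvalue of multiplicity $d\ge 1$ if $\det p(z)$ has degree $N-d$. A subspace $\mathcal V\subset\mathbb{C}^N$ of dimension $\ell$ is a deflating subspace of a regular pencil $p(z)=E+zF$ if there is a subspace $\mathcal W\subset\mathbb{C}^N$ of dimension $\ell$ with $E\mathcal V\subset\mathcal W$ and $F\mathcal V\subset\mathcal W$. If the columns of $V,W\in\mathbb{C}^{N\times\ell}$ are bases of $\mathcal V,\mathcal W$, then $EV=WE'$, $FV=WF'$ for some $E',F'\in\mathbb{C}^{\ell\times\ell}$; the pencil $E'+zF'$ is regular, and its eigenvalues are the eigenvalues of $p(z)$ associated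 with $\mathcal V$. A set $\mathcal S\subset\mathbb{C}\cup\{\infty\}$ is reciprocal-free if there is no $\lambda\in\mathbb{C}\cup\{\infty\}$ with both $\lambda\in\mathcal S$ and $1/\lambda\in\mathcal S$, with the conventions $1/0=\infty$, $1/\infty=0$ (in particular $\pm1\notin\mathcal S$). *)

(* Defs.v *)
From mathcomp Require Import all_boot all_order all_algebra.
From mathcomp Require Import classical_sets reals.
From mathcomp Require Import complex.

Set Implicit Arguments.
Unset Strict Implicit.
Unset Printing Implicit Defensive.

Import Order.TTheory GRing.Theory Num.Theory.

Local Open Scope ring_scope.

Section Pencil.
Variables (K : fieldType) (N : nat).
Implicit Types (E F : 'M[K]_N) (V W : {vspace 'cV[K]_N}).

(* The pencil E + z F, with the indeterminate 'X in the role of z. *)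
Definition pencil E F : 'M[{poly K}]_N :=
  map_mx polyC E + 'X *: map_mx polyC F.

Definition regular_pencil E F : Prop := \det (pencil E F) != 0.

(* [size p] is [1 + deg p]: for a regular pencil this is N - deg (det p). *)
Definition infinity_multiplicity E F : nat :=
  (N - (size (\det (pencil E F))).-1)%N.

(* The extended plane K u {oo} is [option K], with [None] for oo. Only
   meaningful for regular pencils. *)
Definition pencil_eigenvalues E F : set (option K) :=
  fun lambda => match lambda with
  | Some z => root (\det (pencil E F)) z
  | None => (0 < infinity_multiplicity E F)%N
  end.

Definition deflating_witness E F V W : Prop :=
  [/\ \dim W = \dim V,
      (linfun (mulmx E) @: V <= W)%VS
    & (linfun (mulmx F) @: V <= W)%VS].

Definition deflating_subspace E F V : Prop :=
  exists W, deflating_witness E F V W.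

Definition columns_basis l (M : 'M[K]_(N, l)) V : Prop :=
  basis_of V [seq col j M | j <- enum 'I_l].

End Pencil.

(* Eigenvalues of E + z F associated with V. For a regular pencil, W = E V + F V
   is forced, and changing the two bases turns E' + z F' into an equivalent
   pencil, so the set does not depend on the existential witnesses. *)
Definition associated_eigenvalues (K : fieldType) (N : nat) (E F : 'M[K]_N)
    (V : {vspace 'cV[K]_N}) : set (option K) :=
  fun lambda =>
    exists (W : {vspace 'cV[K]_N}) (Vb Wb : 'M[K]_(N, \dim V))
           (E' F' : 'M[K]_(\dim V)),
      [/\ deflating_witness E F V W,
          columns_basis Vb V /\ columns_basis Wb W,
          E *m Vb = Wb *m E' /\ F *m Vb = Wb *m F'
        & pencil_eigenvalues E' F' lambda].

Definition ext_inv (K : fieldType) (lambda : option K) : option K :=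
  match lambda with
  | Some z => if z == 0 then None else Some z^-1
  | None => Some 0
  end.

Definition reciprocal_free (K : fieldType) (S : set (option K)) : Prop :=
  ~ exists lambda, S lambda /\ S (ext_inv lambda).

Notation MtoC := (map_mx (real_complex _)).

(* Main.v *)
(* Let [U], [W] be basis matrices with [M U = W E'] and [M^T U = W F']. Then
   [G = U^T W] satisfies [G E' = U^T M U = F'^T G^T], a palindromic Sylvester
   equation whose only solution is [0] because the spectrum of [E' + z F'] is
   reciprocal-free. Hence the left kernel of [W] is spanned by the columns of
   [U]. If [v] annihilates the lower block row of [M + z M^T], then [(0, v)]
   annihilates [(M + z M^T) U = W (E' + z F')], so, [z] not being an eigenvalue,
   [(0, v)] annihilates [W] and equals [U y] for some [y]; the upper block reads
   [U1 y = 0], whence [y = 0] and [v = 0]. *)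

Require Import Defs.
From mathcomp Require Import all_boot all_order all_algebra perm.
From mathcomp Require Import classical_sets reals.
From mathcomp Require Import complex.

Set Implicit Arguments.
Unset Strict Implicit.
Unset Printing Implicit Defensive.

Import Order.TTheory GRing.Theory Num.Theory.

Local Open Scope ring_scope.

Lemma mulmx_sum_col (K : fieldType) m l (A : 'M[K]_(m, l)) (x : 'cV[K]_l) :
  A *m x = \sum_i x i 0 *: col i A.
Proof.
apply/colP => i; rewrite summxE mxE.
by apply: eq_bigr => j _; rewrite !mxE mulrC.
Qed.

Lemma nonunitmx_kernel (K : fieldType) m (A : 'M[K]_m) (v : 'rV[K]_m) :
  v != 0 -> v *m A = 0 -> A \notin unitmx.
Proof.
move=> v0 vA; apply: contraNN v0 => uA.
by rewrite -(mulmxK uA v) vA mul0mx.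
Qed.

Lemma vspace_columns_basis (K : fieldType) N l (V : {vspace 'cV[K]_N}) :
  \dim V = l -> exists Vb : 'M[K]_(N, l), columns_basis Vb V.
Proof.
move=> <-; exists (\matrix_(i, j) tnth (vbasis V) j i 0).
rewrite /columns_basis (_ : [seq _ | j <- _] = vbasis V) ?vbasisP //.
rewrite -[RHS]map_tnth_enum; apply: eq_map => j.
by apply/colP => i; rewrite !mxE.
Qed.

Lemma columns_basis_tuple (K : fieldType) N l (Vb : 'M[K]_(N, l))
    (V : {vspace 'cV[K]_N}) :
  columns_basis Vb V ->
  exists2 X : l.-tuple 'cV[K]_N, basis_of V X & forall i : 'I_l, X`_i = col i Vb.
Proof.
move=> bV; exists (map_tuple (fun j => col j Vb) (ord_tuple l)) => [|i].
  exact: bV.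
by rewrite -tnth_nth tnth_map tnth_ord_tuple.
Qed.

Lemma columns_basis_rank (K : fieldType) N l (Vb : 'M[K]_(N, l))
    (V : {vspace 'cV[K]_N}) :
  columns_basis Vb V -> \rank Vb = l.
Proof.
move=> /columns_basis_tuple[X /andP[_ /freeP fX] XE].
rewrite -mxrank_tr; apply/eqP/inj_row_free => v /(congr1 trmx).
rewrite trmx_mul trmxK trmx0 mulmx_sum_col => v0.
apply/rowP => i; rewrite [RHS]mxE.
have <- : v^T i 0 = v 0 i by rewrite mxE.
apply: (fX (fun i => v^T i 0)); rewrite -{}[RHS]v0.
by apply: eq_bigr => j _; rewrite XE.
Qed.

Lemma columns_basis_mem (K : fieldType) N l (Vb : 'M[K]_(N, l))
    (V : {vspace 'cV[K]_N}) (v : 'cV[K]_N) :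
  columns_basis Vb V -> v \in V -> exists x, v = Vb *m x.
Proof.
move=> /columns_basis_tuple[X bX XE] vV; exists (\col_i coord X i v).
rewrite mulmx_sum_col {1}(coord_basis bX vV).
by apply: eq_bigr => i _; rewrite mxE XE.
Qed.

Lemma columns_basis_image (K : fieldType) N l (E : 'M[K]_N)
    (Vb Wb : 'M[K]_(N, l)) (V W : {vspace 'cV[K]_N}) :
  columns_basis Vb V -> columns_basis Wb W ->
  (linfun (mulmx E) @: V <= W)%VS ->
  exists E' : 'M[K]_l, E *m Vb = Wb *m E'.
Proof.
move=> bV bW /subvP EVW.
have colV j : exists x, E *m col j Vb = Wb *m x.
  apply: (columns_basis_mem bW); rewrite -(lfunE (mulmx E)) EVW ?memv_img //.
  by apply: (basis_mem bV); apply/mapP; exists j; rewrite ?mem_enum.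
have [f fE] := fin_all_exists colV; exists (\matrix_(i, j) f j i 0).
apply/matrixP => i j; have /colP/(_ i) := fE j.
rewrite !mxE => eq_ij; under [RHS]eq_bigr do rewrite mxE.
by rewrite -eq_ij; under [RHS]eq_bigr do rewrite mxE.
Qed.

(** The definition indexes its matrices by [\dim V]; eliminating [\dim V = l] lets witnesses of size
    [l] be used without casts. *)
Lemma associated_eigenvalues_intro (K : fieldType) N l (E F : 'M[K]_N)
    (V W : {vspace 'cV[K]_N}) (Vb Wb : 'M[K]_(N, l)) (E' F' : 'M[K]_l) lambda :
  \dim V = l -> deflating_witness E F V W ->
  columns_basis Vb V -> columns_basis Wb W ->
  E *m Vb = Wb *m E' -> F *m Vb = Wb *m F' ->
  pencil_eigenvalues E' F' lambda -> associated_eigenvalues E F V lambda.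
Proof.
move=> dV; case: l / dV Vb Wb E' F' => Vb Wb E' F' *.
by exists W, Vb, Wb, E', F'; split.
Qed.

(** Evaluation at [z] is a ring morphism, so it commutes with the determinant. *)
Lemma root_det_pencil (K : fieldType) m (E F : 'M[K]_m) z :
  root (\det (pencil E F)) z = (E + z *: F \notin unitmx).
Proof.
rewrite unitmxE unitfE negbK /root -[_.[z]]/(horner_eval z _) -det_map_mx.
congr (\det _ == 0); apply/matrixP => i j.
by rewrite /pencil !mxE /= /horner_eval !hornerE.
Qed.

Lemma coef_prod_linear (K : fieldType) I (s : seq I) (a b : I -> K) :
  let p := \prod_(i <- s) ((a i)%:P + 'X * (b i)%:P) in
  (size p <= (size s).+1)%N /\ p`_(size s) = \prod_(i <- s) b i.
Proof.
elim: s => [|i s /= [IHs IHc]] /=; first by rewrite !big_nil size_poly1 coef1.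
rewrite !big_cons -IHc; set p := \prod_(j <- s) _ in IHs *.
rewrite mulrDl -mulrA mul_polyC; split.
  apply: leq_trans (size_polyD _ _) _; rewrite geq_max.
  rewrite (leq_trans (size_scale_leq _ _) (leqW IHs)) /=.
  rewrite (leq_trans (size_polyMleq _ _)) // size_polyX mul_polyC /= ltnS.
  exact: leq_trans (size_scale_leq _ _) IHs.
rewrite coefD coefZ coefXM coefCM /=.
by rewrite (nth_default _ IHs) mulr0 add0r.
Qed.

(** In the Leibniz expansion every term is a signed product of [m] linear factors, and its
    coefficient of degree [m] is the corresponding term of [\det F]. *)
Lemma coef_det_pencil (K : fieldType) m (E F : 'M[K]_m) :
  (size (\det (pencil E F)) <= m.+1)%N /\ (\det (pencil E F))`_m = \det F.
Proof.
have prodP (s : 'S_m) :=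
  coef_prod_linear (index_enum 'I_m) (fun i => E i (s i)) (fun i => F i (s i)).
have sz : size (index_enum 'I_m) = m by rewrite /index_enum -enumT size_enum_ord.
have prodE (s : 'S_m) : \prod_i pencil E F i (s i) =
    \prod_i ((E i (s i))%:P + 'X * (F i (s i))%:P).
  by apply: eq_bigr => i _; rewrite !mxE.
rewrite /determinant; split.
  apply: leq_trans (size_sum _ _ _) _; apply/bigmax_leqP => s _.
  by rewrite -signr_odd mulr_sign; case: ifP => _; rewrite ?size_polyN prodE;
    have [+ _] := prodP s; rewrite sz.
rewrite coef_sum; apply: eq_bigr => s _; rewrite prodE.
have [_] := prodP s; rewrite sz => <-.
by case: (odd_perm s); rewrite ?expr1 ?expr0 ?mulN1r ?mul1r ?coefN.
Qed.

Lemma eigenvalue_pencil_infinity (K : fieldType) m (E F : 'M[K]_m) :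
  F \notin unitmx -> pencil_eigenvalues E F None.
Proof.
rewrite unitmxE unitfE negbK => /eqP F0.
have [szP cP] := coef_det_pencil E F; rewrite /= /infinity_multiplicity.
(* Positivity of [m] settles the case where the determinant is the zero polynomial: its size is 0,
   and so is the predecessor of that size. *)
have m_gt0 : (0 < m)%N.
  by case: m E F F0 {szP cP} => // E F /eqP; rewrite det_mx00 oner_eq0.
rewrite subn_gt0; set p := \det _ in szP cP *.
have : (size p <= m)%N.
  by apply/leq_sizeP => j; rewrite leq_eqVlt => /predU1P[<-|mj];
    [rewrite cP | apply: (leq_sizeP _ _ szP)].
by case: (size p) => [|k].
Qed.

(* Peeling off one factor of [prod (T - a)] at a time preserves the Stein
   equation, and [H (T - a) = 0] gives [(1 - a L) H = 0]. *)
Lemma stein_factors (K : fieldType) m (L T : 'M[K]_m.+1) (s : seq K) :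
  (forall a, a \in s -> 1%:M - a *: L \in unitmx) ->
  forall H, L *m H *m T = H ->
  H *m horner_mx T (\prod_(a <- s) ('X - a%:P)) = 0 -> H = 0.
Proof.
elim: s => [|a s IHs] us H HE.
  by rewrite big_nil rmorph1 mulmx1.
rewrite big_cons rmorphM rmorphB /= horner_mx_X horner_mx_C mulmxA => H0.
have Ha : H *m (T - a%:M) = 0.
  apply: IHs H0 => [b bs|]; first by rewrite us // inE bs orbT.
  rewrite mulmxA -!mulmxA (_ : (T - a%:M) *m T = T *m (T - a%:M)).
    by rewrite !mulmxA HE.
  by rewrite mulmxBl mulmxBr scalar_mxC.
have aH : (1%:M - a *: L) *m H = 0.
  rewrite mulmxBl mul1mx -[X in X - _]HE -scalemxAl -mul_mx_scalar.
  by rewrite -mulmxBr -mulmxA Ha mulmx0.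
by rewrite -(mulKmx (us a (mem_head _ _)) H) aH mulmx0.
Qed.

(** The characteristic polynomial of [T] splits and, by Cayley-Hamilton, annihilates [T]; its roots
    are the factors to peel off. *)
Lemma stein_eq0 (K : closedFieldType) m (L T H : 'M[K]_m) :
  (forall a, eigenvalue T a -> 1%:M - a *: L \in unitmx) ->
  L *m H *m T = H -> H = 0.
Proof.
case: m L T H => [|m] L T H uL HE; first exact: flatmx0.
have [s sE] := closed_field_poly_normal (char_poly T).
move: sE; rewrite (monicP (char_poly_monic T)) scale1r => sE.
apply: (@stein_factors _ _ L T s) => // [a a_s|]; last first.
  by rewrite -sE Cayley_Hamilton mulmx0.
by apply: uL; rewrite eigenvalue_root_char sE root_prod_XsubC.
Qed.

(** Transposing the equation gives a second one, [G *m F = E^T *m G^T]. Eliminating [G^T] between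
    the two leaves a Stein equation for [G], with [L = F^T *m invmx E^T] and [T = F *m invmx E]. *)
Lemma palindromic_sylvester_eq0 (K : closedFieldType) m (E F G : 'M[K]_m) :
  E \in unitmx ->
  (forall a, F - a *: E \in unitmx \/ E - a *: F \in unitmx) ->
  G *m E = F^T *m G^T -> G = 0.
Proof.
move=> uE disj GE; have uET : E^T \in unitmx by rewrite unitmx_tr.
have GF : G *m F = E^T *m G^T by rewrite -[LHS]trmxK trmx_mul -GE trmx_mul.
apply: (@stein_eq0 _ _ (F^T *m invmx E^T) (F *m invmx E)) => [a|]; last first.
  by rewrite mulmxA -!mulmxA (mulmxA G) GF !mulmxA mulmxKV // -GE mulmxK.
move=> /eigenvalueP[v vE v0].
have nF : F - a *: E \notin unitmx.
  apply: (nonunitmx_kernel v0); rewrite mulmxBr -scalemxAr scalemxAl -vE.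
  by rewrite !mulmxA mulmxKV // subrr.
have [uF|uF] := disj a; first by rewrite uF in nF.
(* Here [1 - a L] factors as [(E - a F)^T] times the inverse of [E^T]. *)
rewrite -(mulmxV uET) scalemxAl -mulmxBl unitmx_mul unitmx_inv uET andbT.
by rewrite -linearZ -linearB unitmx_tr.
Qed.

Lemma reciprocal_free_sylvester_eq0 (K : closedFieldType) m (E F G : 'M[K]_m)
    (S : set (option K)) :
  (forall lambda, pencil_eigenvalues E F lambda -> S lambda) ->
  reciprocal_free S -> G *m E = F^T *m G^T -> G = 0.
Proof.
move=> ES rS GE.
have root_S z : E + z *: F \notin unitmx -> S (Some z).
  by move=> nE; apply: ES; rewrite /= root_det_pencil.
have GF : G *m F = E^T *m G^T by rewrite -[LHS]trmxK trmx_mul -GE trmx_mul.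
have recip a : a != 0 -> F - a *: E \in unitmx \/ E - a *: F \in unitmx.
  move=> a0; case: (boolP (F - a *: E \in unitmx)) => [|nF]; first by left.
  case: (boolP (E - a *: F \in unitmx)) => [|nE]; first by right.
  (* The pencil is [E + z F], whence the sign: singularity of [E - a F] gives the eigenvalue [- a],
     and that of [F - a E] gives its reciprocal. *)
  case: rS; exists (Some (- a)); rewrite /= oppr_eq0 (negPf a0).
  split; apply: root_S; first by rewrite scaleNr.
  apply: contraNN nF => uE.
  rewrite (_ : _ - _ = (- a) *: (E + (- a)^-1 *: F)) ?unitmxZ ?unitfE ?oppr_eq0 //.
  by rewrite scalerDr scalerA divff ?oppr_eq0 // scale1r scaleNr addrC.
(* The transposed equation [GF] has the same form with [E] and [F] exchanged, so invertibility of
   either one suffices. If both were singular, infinity and its reciprocal 0 would lie in [S]. *)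
have [uF|nF] := boolP (F \in unitmx).
  apply: (palindromic_sylvester_eq0 uF) GF => a.
  have [->|/recip] := eqVneq a 0; first by right; rewrite scale0r subr0.
  by case; [right | left].
have uE : E \in unitmx.
  apply: contraT => nE; case: rS; exists None; split => /=.
    by apply: ES; apply: eigenvalue_pencil_infinity.
  by apply: root_S; rewrite scale0r addr0.
apply: (palindromic_sylvester_eq0 uE) GE => a.
have [->|/recip] := eqVneq a 0; first by right; rewrite scale0r subr0.
by [].
Qed.


Theorem theorem7 (R : realType) (n : nat) (A B C D : 'M[R]_n)
    (M : 'M[R[i]]_(n + n)) (hM : M = MtoC (block_mx C D A (- B)))
    (hreg : regular_pencil M M^T)
    (U : {vspace 'cV[R[i]]_(n + n)})
    (hUdim : \dim U = n)
    (hUdefl : deflating_subspace M M^T U)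
    (S : set (option R[i]))
    (hS : S = associated_eigenvalues M M^T U)
    (hSfree : reciprocal_free S)
    (U1 U2 : 'M[R[i]]_n)
    (hUbasis : columns_basis (col_mx U1 U2) U)
    (hU1 : U1 \in unitmx)
    (z : R[i]) (hz : ~ S (Some z)) :
  \rank (row_mx (MtoC A + z *: MtoC D^T) (- MtoC B - z *: MtoC B^T)) = n.
Proof.
have [W Wdefl] := hUdefl; have [dW MU MtU] := Wdefl.
have [Wb bW] := vspace_columns_basis (etrans dW hUdim).
set Ub := col_mx U1 U2 in hUbasis.
have [E' EE] := columns_basis_image hUbasis bW MU.
have [F' FE] := columns_basis_image hUbasis bW MtU.
have toS lambda : pencil_eigenvalues E' F' lambda -> S lambda.
  rewrite hS.
  exact: associated_eigenvalues_intro hUdim Wdefl hUbasis bW EE FE.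
have UW0 : Ub^T *m Wb = 0.
  apply: (reciprocal_free_sylvester_eq0 toS hSfree).
  rewrite trmx_mul trmxK mulmxA -trmx_mul -FE trmx_mul trmxK.
  by rewrite -!mulmxA EE.
have uz : E' + z *: F' \in unitmx.
  apply: contraT => nz; case: hz; apply: toS.
  by rewrite /= root_det_pencil.
(* The inclusion just proved is an equality by dimension: both row spaces have rank [n], since [Wb]
   has [n + n] rows and rank [n]. *)
have kerW : (kermx Wb <= Ub^T)%MS.
  have sUW : (Ub^T <= kermx Wb)%MS by apply/sub_kermxP.
  rewrite -(mxrank_leqif_sup sUW) mxrank_tr (columns_basis_rank hUbasis).
  by rewrite mxrank_ker (columns_basis_rank bW) addnK.
apply/eqP/inj_row_free => v v0.
(* The zero block selects the lower block row of [M + z *: M^T], which is the matrix of the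
   statement. *)
have phiE : row_mx 0 v *m (M + z *: M^T) = 0.
  rewrite hM map_block_mx tr_block_mx scale_block_mx add_block_mx mul_row_block.
  rewrite !mul0mx !add0r -mul_mx_row -v0 !map_trmx.
  congr (_ *m row_mx _ _); apply/matrixP => i j.
  by rewrite !mxE !rmorphN mulrN.
have /sub_kermxP vW : row_mx 0 v *m Wb = 0.
  apply: (can_inj (mulmxK uz)); rewrite mul0mx -mulmxA mulmxDr -scalemxAr -EE -FE.
  by rewrite scalemxAl -mulmxDl mulmxA phiE mul0mx.
have /submxP[y] := submx_trans vW kerW.
(* The two blocks read [0 = y *m U1^T] and [v = y *m U2^T]; the first forces [y = 0]. *)
rewrite tr_col_mx mul_mx_row => /eq_row_mx[y0 ->].
have -> : y = 0 by rewrite -(mulmxK (etrans (unitmx_tr _) hU1) y) -y0 mul0mx.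
by rewrite mul0mx.
Qed.
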